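(* Let $n\geq 2$ and let $a\in\mathbb{R}^{n(n-1)}$ have entries $a_{ij}$, $i\neq j$, $i,j\in[n]$. Let $S$ denote the set of optimal permutations for $\operatorname{LOP}(a)$. Then the optimal diameter of $\operatorname{LOP}(a)$ satisfies $$\operatorname{d}(\operatorname{LOP}(a))=2\cdot\max_{\sigma_{1},\sigma_{2}\in S}K(\sigma_{1},\sigma_{2}).$$
   Context: $[n]=\{1,\ldots,n\}$ and $S_n$ is the set of permutations of $[n]$. The linear ordering problem $\operatorname{LOP}(a)$ is: maximize $\sum_{i\neq j}a_{ij}x_{ij}$ subject to $x_{ij}+x_{ji}=1$ for all $i<j$ in $[n]$; $x_{ij}+x_{jk}+x_{ki}\leq 2$ for all $i,j,k\in[n]$ with $i<j$, $i<k$, $j\neq k$; and $x_{ij}\in\{0,1\}$ for all $i\neq j$ in $[n]$. Each feasible solution $\bar x$ corresponds to a unique permutation $\sigma\in S_n$ via $\bar{x}_{ij}=1$ if and only if $\sigma(i)<\sigma(j)$; $\sigma$ is an optimal permutation if it corresponds to an optimal solution of $\operatorname{LOP}(a)$. The optimal diameter $\operatorname{d}(\operatorname{LOP}(a))$ is the maximum of $\|x^*-y^*\|^2$ (Euclidean norm) over all pairs of optimal solutions $x^*,y^*$. The Kendall tau distance is $K(\sigma_1,\sigma_2)=|D(\sigma_1,\sigma_2)|$, where $D(\sigma_1,\sigma_2)$ is the set of pairs $(i,j)\in[n]\times[n]$ with $i<j$ such that either $\sigma_1(i)<\sigma_1(j)$ and $\sigma_2(i)>\sigma_2(j)$, or $\sigma_1(i)>\sigma_1(j)$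 and $\sigma_2(i)<\sigma_2(j)$. *)

(* Defs.v *)
From HB Require Import structures.
From mathcomp Require Import all_boot all_order all_algebra all_fingroup.
From mathcomp Require Import boolp classical_sets reals.

Set Implicit Arguments.
Unset Strict Implicit.
Unset Printing Implicit Defensive.

Import Order.TTheory GRing.Theory Num.Theory.
Local Open Scope ring_scope.

(* [n] is 'I_n (numbered from 0).  A vector of R^(n(n-1)) is a finite function
   on the ordered pairs of distinct indices, so there are no diagonal
   coordinates.  [x (mkpair ij)] with [ij : i != j] is the coordinate x_ij. *)
Definition offdiag (n : nat) := {p : 'I_n * 'I_n | p.1 != p.2}.

Definition vec (R : Type) (n : nat) := {ffun offdiag n -> R}.

Definition mkpair (n : nat) (i j : 'I_n) (ij : i != j) : offdiag n :=
  exist (fun p : 'I_n * 'I_n => p.1 != p.2) (i, j) ij.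

Definition feasible (R : realType) (n : nat) (x : vec R n) : Prop :=
  [/\ forall (i j : 'I_n) (ij : i != j) (ji : j != i), (i < j)%N ->
        x (mkpair ij) + x (mkpair ji) = 1,
      forall (i j k : 'I_n) (ij : i != j) (jk : j != k) (ki : k != i),
        (i < j)%N -> (i < k)%N -> x (mkpair ij) + x (mkpair jk) + x (mkpair ki) <= 2
    & forall (i j : 'I_n) (ij : i != j), x (mkpair ij) = 0 \/ x (mkpair ij) = 1].

Definition objective (R : realType) (n : nat) (a x : vec R n) : R :=
  \sum_(p : offdiag n) a p * x p.

Definition optimal (R : realType) (n : nat) (a x : vec R n) : Prop :=
  feasible x /\
  forall y : vec R n, feasible y -> objective a y <= objective a x.

Definition corresponds (R : realType) (n : nat) (x : vec R n) (s : 'S_n)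
  : Prop :=
  forall (i j : 'I_n) (ij : i != j), x (mkpair ij) = 1 <-> (s i < s j)%N.

Definition optimal_perm (R : realType) (n : nat) (a : vec R n) (s : 'S_n)
  : Prop :=
  exists x : vec R n, optimal a x /\ corresponds x s.

Definition optimal_perms (R : realType) (n : nat) (a : vec R n) : {set 'S_n} :=
  finset (fun s => `[< optimal_perm a s >]).

Definition euclidean_norm (R : realType) (n : nat) (x : vec R n) : R :=
  Num.sqrt (\sum_(p : offdiag n) x p ^+ 2).

Definition is_maximum (R : realType) (A : set R) (m : R) : Prop :=
  A m /\ ubound A m.

(* [is_optimal_diameter a d] is d(LOP(a)) = d; it includes the fact that the
   maximum is attained. *)
Definition is_optimal_diameter (R : realType) (n : nat) (a : vec R n) (d : R)
  : Prop :=
  is_maximum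
    (fun r => exists x y : vec R n,
       [/\ optimal a x, optimal a y & r = euclidean_norm (x - y) ^+ 2]) d.

Definition kendall_set (n : nat) (s1 s2 : 'S_n) : {set 'I_n * 'I_n} :=
  finset (fun p : 'I_n * 'I_n =>
    (p.1 < p.2)%N &&
    (((s1 p.1 < s1 p.2)%N && (s2 p.1 > s2 p.2)%N) ||
     ((s1 p.1 > s1 p.2)%N && (s2 p.1 < s2 p.2)%N))).

Definition kendall_tau (n : nat) (s1 s2 : 'S_n) : nat := #|kendall_set s1 s2|.

(* Main.v *)
Require Import Defs.
From HB Require Import structures.
From mathcomp Require Import all_boot all_order all_algebra all_fingroup.
From mathcomp Require Import boolp classical_sets reals.
Import Order.TTheory GRing.Theory Num.Theory.
Local Open Scope ring_scope.

(** A feasible point is the 0/1 encoding of a tournament on the indices: the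
    equations make it a tournament, and the 3-cycle inequalities make it
    transitive.  A transitive tournament is a linear order, so it is read off
    from exactly one permutation, namely the one that sends an index to its
    number of predecessors ([feasible_corresponds]); conversely every
    permutation encodes to a feasible point ([perm_vec_feasible]).  Optimal
    points and optimal permutations are therefore in bijection.

    Two encodings differ by 0 or by 1 in absolute value at each coordinate, so
    the squared distance counts the coordinates where they differ.  A discordant
    pair of indices is counted once for each of its two orders, whence the
    factor 2 ([perm_vec_dist]).

    As there are finitely many permutations and at least one of them, an optimal
    permutation exists, which makes both maxima attained at the same pair. *)

Definition perm_vec (R : realType) {n : nat} (s : 'S_n) : vec R n :=
  [ffun p : offdiag n => (s (val p).1 < s (val p).2)%N%:R].

Lemma perm_ltnNge {n : nat} (s : 'S_n) {i j : 'I_n} :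
  i != j -> (s j < s i)%N = ~~ (s i < s j)%N.
Proof.
move=> ij; have : s i != s j by apply: contra ij => /eqP /perm_inj ->.
by rewrite -val_eqE /=; case: ltngtP.
Qed.

Lemma perm_vec_feasible (R : realType) {n : nat} (s : 'S_n) :
  feasible (perm_vec R s).
Proof.
split=> [i j ij ji _|i j k ij jk ki _ _|i j ij]; rewrite !ffunE /=.
- by rewrite (perm_ltnNge s ij); case: (s i < s j)%N; rewrite ?addr0 ?add0r.
- rewrite -!natrD ler_nat.
  have [hij|] := ltnP (s i) (s j); last by case: (_ < _)%N; case: (_ < _)%N.
  have [hjk|] := ltnP (s j) (s k); last by case: (_ < _)%N.
  by rewrite ltnNge (ltnW (ltn_trans hij hjk)).
- by case: (_ < _)%N; [right|left].
Qed.

Lemma perm_vec_corresponds (R : realType) {n : nat} (s : 'S_n) :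
  corresponds (perm_vec R s) s.
Proof.
move=> i j ij; rewrite ffunE /=; case: (_ < _)%N; split=> // /eqP.
by rewrite eq_sym oner_eq0.
Qed.

Lemma corresponds_perm_vec {R : realType} {n : nat} {x : vec R n} {s : 'S_n} :
  feasible x -> corresponds x s -> x = perm_vec R s.
Proof.
move=> [_ _ x01] xs; apply/ffunP => -[[i j] ij]; rewrite ffunE /=.
have := xs i j ij; have := x01 i j ij; rewrite /mkpair.
case=> -> [h1 h2]; last by rewrite h1.
case: ltnP => // /h2 /eqP; by rewrite eq_sym oner_eq0.
Qed.

(** The inequalities are imposed only with the least index first; the left-hand
    side is invariant under rotation, so they hold for all triples. *)
Lemma feasible_cycle {R : realType} {n : nat} {x : vec R n} (fx : feasible x)
    {i j k : 'I_n} (ij : i != j) (jk : j != k) (ki : k != i) :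
  x (mkpair ij) + x (mkpair jk) + x (mkpair ki) <= 2.
Proof.
have [_ fc _] := fx; have [[ij' jk'] ki'] := (ij, jk, ki).
move: ij' jk' ki'; rewrite -!val_eqE /= => ij' jk' ki'.
have [lij|lji] : (i < j)%N \/ (j < i)%N by move: ij'; case: ltngtP; auto.
- have [lki|lik] : (k < i)%N \/ (i < k)%N by move: ki'; case: ltngtP; auto.
  + by rewrite addrC addrA; apply: fc => //; apply: ltn_trans lij.
  + exact: fc.
- have [ljk|lkj] : (j < k)%N \/ (k < j)%N by move: jk'; case: ltngtP; auto.
  + by rewrite -addrA addrC; apply: fc.
  + by rewrite addrC addrA; apply: fc => //; apply: ltn_trans lji.
Qed.

(** Coordinates exist only off the diagonal; extending by [false] on it gives a
    strict relation on all indices. *)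
Definition precedes {R : realType} {n : nat} (x : vec R n) : rel 'I_n :=
  fun i j => if insub (i, j) is Some p then x p == 1 else false.

Lemma precedesE {R : realType} {n : nat} (x : vec R n) {i j : 'I_n}
    (ij : i != j) :
  precedes x i j = (x (mkpair ij) == 1).
Proof.
rewrite /precedes; case: insubP => [p _ vp|]; last by rewrite ij.
by congr (x _ == 1); apply: val_inj.
Qed.

Lemma precedes_irr {R : realType} {n : nat} (x : vec R n) (i : 'I_n) :
  precedes x i i = false.
Proof. by rewrite /precedes; case: insubP => //= p; rewrite eqxx. Qed.

Lemma precedes_total {R : realType} {n : nat} {x : vec R n} {i j : 'I_n} :
  feasible x -> i != j -> precedes x j i = ~~ precedes x i j.
Proof.
move=> [fe _ x01] ij; have ji : j != i by rewrite eq_sym.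
rewrite (precedesE x ij) (precedesE x ji).
have E : x (mkpair ij) + x (mkpair ji) = 1.
  have := ij; rewrite -val_eqE /=; case: ltngtP => // l _; first exact: fe.
  by rewrite addrC; apply: fe.
have -> : x (mkpair ji) = 1 - x (mkpair ij) by rewrite -E addrC addKr.
case: (x01 i j ij) => ->; first by rewrite subr0 eqxx eq_sym oner_eq0.
by rewrite subrr eqxx eq_sym oner_eq0.
Qed.

(** If the last arc were reversed, the three arcs would close up to a cycle with
    coordinate sum 3. *)
Lemma precedes_trans {R : realType} {n : nat} {x : vec R n} :
  feasible x -> transitive (precedes x).
Proof.
move=> fx j i k pij pjk.
have ij : i != j by apply: contraTneq pij => ->; rewrite precedes_irr.
have jk : j != k by apply: contraTneq pjk => ->; rewrite precedes_irr.
have ki : k != i.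
  by apply: contraTneq pjk => ->; rewrite (precedes_total fx ij) pij.
rewrite (precedes_total fx ki); apply/negP => pki.
have := feasible_cycle fx ij jk ki; move: pij pjk pki.
rewrite (precedesE x ij) (precedesE x jk) (precedesE x ki).
move=> /eqP -> /eqP -> /eqP ->.
by rewrite -[X in X <= _]/(1%:R + 1%:R + 1%:R) -!natrD ler_nat.
Qed.

(** Predecessor counts are strictly increasing along a transitive tournament,
    hence injective, hence a permutation realizing it. *)
Lemma feasible_corresponds {R : realType} {n : nat} {x : vec R n} :
  feasible x -> exists s : 'S_n, corresponds x s.
Proof.
move=> fx; pose P i := [set j | precedes x j i].
have ltP i j : precedes x i j -> (#|P i| < #|P j|)%N.
  move=> pij; apply/proper_card/properP; split.
    by apply/fintype.subsetP => k; rewrite !inE => pki; apply: precedes_trans pij.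
  by exists i; rewrite inE // precedes_irr.
have ltn_P i : (#|P i| < n)%N.
  rewrite -[X in (_ < X)%N]card_ord -cardsT; apply/proper_card/properP.
  by split; [exact: finset.subsetT | exists i; rewrite inE // precedes_irr].
pose f i := Ordinal (ltn_P i).
have f_inj : injective f.
  move=> i j /(congr1 val) /= eP; apply/eqP/negPn/negP => ij.
  have := precedes_total fx ij; case E : (precedes x i j).
    by move: (ltP _ _ E); rewrite eP ltnn.
  by move=> /ltP; rewrite eP ltnn.
exists (perm f_inj) => i j ij; rewrite !permE /=.
split=> [/eqP|lt_ij]; first by rewrite -precedesE => /ltP.
apply/eqP; rewrite -precedesE; apply: contraLR lt_ij.
by rewrite -(precedes_total fx ij) -leqNgt => /ltP /ltnW.
Qed.

Lemma optimal_permP {R : realType} {n : nat} (a : vec R n) (s : 'S_n) :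
  reflect (optimal a (perm_vec R s)) (s \in optimal_perms a).
Proof.
rewrite inE; apply: (iffP (asboolP _)) => [[x [ox xs]]|os].
  by rewrite -(corresponds_perm_vec ox.1 xs).
by exists (perm_vec R s); split=> //; apply: perm_vec_corresponds.
Qed.

Lemma optimal_perm_vec {R : realType} {n : nat} {a x : vec R n} :
  optimal a x -> exists2 s, s \in optimal_perms a & x = perm_vec R s.
Proof.
move=> ox; have [s xs] := feasible_corresponds ox.1.
have xE := corresponds_perm_vec ox.1 xs.
by exists s => //; apply/optimal_permP; rewrite -xE.
Qed.

Lemma optimal_perms_neq0 {R : realType} {n : nat} (a : vec R n) :
  (0 < #|optimal_perms a|)%N.
Proof.
have [s _ smax] := @Order.TotalTheory.arg_maxP _ R _ (1%g : 'S_n) xpredT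
  (fun s => objective a (perm_vec R s)) isT.
apply/card_gt0P; exists s; apply/optimal_permP; split.
  exact: perm_vec_feasible.
move=> y fy; have [t yt] := feasible_corresponds fy.
by rewrite (corresponds_perm_vec fy yt); apply: smax.
Qed.

Definition discordant {n : nat} (s1 s2 : 'S_n) (p : 'I_n * 'I_n) : bool :=
  (s1 p.1 < s1 p.2)%N != (s2 p.1 < s2 p.2)%N.

Lemma discordant_swap {n : nat} (s1 s2 : 'S_n) {i j : 'I_n} :
  i != j -> discordant s1 s2 (j, i) = discordant s1 s2 (i, j).
Proof.
by move=> ij; rewrite /discordant /= !(perm_ltnNge _ ij) (inj_eq negb_inj).
Qed.

Lemma kendall_tauE {n : nat} (s1 s2 : 'S_n) :
  kendall_tau s1 s2 =
  (\sum_(p : 'I_n * 'I_n | (p.1 < p.2)%N) discordant s1 s2 p)%N.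
Proof.
rewrite /kendall_tau -sum1_card big_mkcond [RHS]big_mkcond /=.
apply: eq_bigr => -[i j] _; rewrite inE /discordant /=.
case: (ltnP i j) => //= lt_ij; have ij : i != j by rewrite -val_eqE neq_ltn lt_ij.
by rewrite !(perm_ltnNge _ ij); do 2!case: (_ < _)%N.
Qed.

(** Swapping the two indices preserves discordance, so the ordered pairs with
    decreasing indices contribute as much as those with increasing ones. *)
Lemma perm_vec_dist (R : realType) {n : nat} (s1 s2 : 'S_n) :
  euclidean_norm (perm_vec R s1 - perm_vec R s2) ^+ 2 =
  2 * (kendall_tau s1 s2)%:R.
Proof.
rewrite /euclidean_norm sqr_sqrtr; last by apply: sumr_ge0 => p _; apply: sqr_ge0.
transitivity ((\sum_(p : offdiag n) discordant s1 s2 (val p))%N%:R : R).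
  rewrite natr_sum; apply: eq_bigr => p _; rewrite !ffunE /discordant.
  by do 2!case: (_ < _)%N; rewrite /= ?subrr ?subr0 ?sub0r ?sqrrN ?expr0n ?expr1n.
rewrite -natrM; congr (_%:R).
transitivity (\sum_(p : 'I_n * 'I_n | p.1 != p.2) discordant s1 s2 p)%N.
  rewrite [RHS](reindex_omap (val : offdiag n -> _) insub) => [|p p_off].
    by apply: eq_bigl => p; rewrite (valP p) valK eqxx.
  by rewrite insubT.
rewrite (bigID (fun p : 'I_n * 'I_n => (p.1 < p.2)%N)) /= mul2n -addnn kendall_tauE.
congr (_ + _)%N.
  by apply: eq_bigl => -[i j] /=; rewrite -val_eqE /=; case: ltngtP.
pose swap (p : 'I_n * 'I_n) := (p.2, p.1).
rewrite (reindex_inj (h := swap)); last by apply: (can_inj (g := swap)); case.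
apply: eq_big => [[i j]|[i j] /= /andP[ji _]].
  by rewrite /= -val_eqE /=; case: ltngtP.
by rewrite discordant_swap // eq_sym.
Qed.

Theorem proposition3p2 (R : realType) (n : nat) (hn : (2 <= n)%N)
    (a : vec R n) :
  is_optimal_diameter a
    (2 * (\max_(s1 in optimal_perms a) \max_(s2 in optimal_perms a)
            kendall_tau s1 s2)%:R).
Proof.
have S0 := optimal_perms_neq0 a; split.
  have [s1 os1 ->] := eq_bigmax_cond (fun s1 : 'S_n =>
    \max_(s2 in optimal_perms a) kendall_tau s1 s2)%N S0.
  have [s2 os2 ->] := eq_bigmax_cond (kendall_tau s1) S0.
  exists (perm_vec R s1), (perm_vec R s2); rewrite perm_vec_dist.
  by split=> //; apply/optimal_permP.
move=> r [x [y [/optimal_perm_vec[s1 os1 ->] /optimal_perm_vec[s2 os2 ->] ->]]].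
rewrite perm_vec_dist ler_pM2l // ler_nat.
apply: leq_trans (leq_bigmax_cond _ os1).
exact: (leq_bigmax_cond (F := kendall_tau s1) _ os2).
Qed.
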